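(* Consider the electricity market model of the context, under Assumptions (A), (B) and the convention (K). For $k\in P\cup C$ let $\tilde{\mathcal Z}_k:\mathbb R^N\setminus\bar S_M\to\mathbb R^N$ be the $\mathbb{PC}^\infty$ mapping that sends an expected electricity price vector $E$ to the optimal electricity volume vector $V_k$ of player $k$ at $E$, and define the $\mathbb{PC}^\infty$ mapping $\tilde{\mathcal Z}(E):=\sum_{p\in P}\tilde{\mathcal Z}_p(E)+\sum_{c\in C}\tilde{\mathcal Z}_c(E)$. If $\mathcal D\tilde{\mathcal Z}^i(x)\prec0$ for all $i\in\mathcal I^e(x)$ and all $x\in\mathbb R^N\setminus\bar S_M$, then the expected electricity price vector in the Nash equilibrium is unique (any two Nash equilibria have the same expected electricity price vector).
   Context: Model. $P$ (producers) and $C$ (consumers) are finite nonempty sets, $L$ is a finite set of fuels, and $R^{p,l}$ is the finite set of power plants of producer $p$ running on fuel $l$. $T_1,\dots,T_{T'}$ are delivery times, $J=\{1,\dots,T'\}$; for $j\in J$ the finite set $I_j$ indexes the trading times $t_i$ for delivery at $T_j$; $N=\sum_{j\in J}|I_j|$. $\hat r\in\mathbb R$ is an interest rate. $\Pi(t_i,T_j)$ (electricity), $G_l(t_i,T_j)$ (fuel $l$) and $G_{em}(t_i,T_j)$ (emissions) are forward prices: real random variables with finite second moments on a probability space with measure $\mathbb P$. $\Pi\in\mathbb R^N$, $G\in\mathbb R^{N|L|}$, $G_{em}\in\mathbb R^N$ denote the vectors of all these prices, each entry with delivery time $T_j$ multiplied by $e^{-\hat rT_j}$. $D(T_j)\in\mathbb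 R$ is the (known) demand, and $p_c\in[0,1]$ with $\sum_{c\in C}p_c=1$. Producer $p$ chooses $v_p=(V_p,F_p,O_p,W_p)$, consisting of real numbers $V_p(t_i,T_j)$, $F_{p,l}(t_i,T_j)$, $O_p(t_i,T_j)$, $W_{p,l,r}(T_j)$ ($j\in J$, $i\in I_j$, $l\in L$, $r\in R^{p,l}$). The feasible set $S_p$ consists of all $v_p$ satisfying the equalities $-\sum_{i\in I_j}V_p(t_i,T_j)=\sum_{l}\sum_{r\in R^{p,l}}W_{p,l,r}(T_j)$ for all $j$; $\sum_{r\in R^{p,l}}c^{p,l,r}W_{p,l,r}(T_j)=\sum_{i\in I_j}F_{p,l}(t_i,T_j)$ for all $j,l$; $\sum_j\sum_{i\in I_j}O_p(t_i,T_j)=\sum_j\sum_l\sum_{r\in R^{p,l}}g^lW_{p,l,r}(T_j)$; and the inequalities ramping: $\triangle\overline W_{min}^{p,l,r}\le W_{p,l,r}(T_{j+1})-W_{p,l,r}(T_j)\le\triangle\overline W_{max}^{p,l,r}$ for $j\in\{1,\dots,T'-1\}$; capacity: $0\le W_{p,l,r}(T_j)\le\overline W_{max}^{p,l,r}$; trading bounds: $|F_{p,l}(t_i,T_j)|\le F_{trade}$; $|O_p(t_i,T_j)|\le F_{trade}$; $|V_p(t_i,T_j)|\le V_{trade}$. Here $c^{p,l,r}>0$, $g^l>0$, the ramping bounds and $\overline W_{max}^{p,l,r}$ are given real constants, and $F_{trade},V_{trade}>0$ are given (large) constants. Consumer $c$ chooses $V_c\in\mathbb R^N$ with entries $V_c(t_i,T_j)$;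 $S_c$ is the set of $V_c$ with $\sum_{i\in I_j}V_c(t_i,T_j)=p_cD(T_j)$ for all $j$ and $|V_c(t_i,T_j)|\le V_{trade}$ for all $i,j$. $E\in\mathbb R^N$ denotes the vector of expected discounted electricity prices (entries $E(t_i,T_j)=e^{-\hat rT_j}\times$ expected value of $\Pi(t_i,T_j)$), chosen by a hypothetical market agent; choosing $E$ shifts the mean of $\Pi$ but leaves all covariances unchanged. Let $\hat Q$ be the covariance matrix under $\mathbb P$ of $(\Pi,G,G_{em})$ and $\hat Q_1$ that of $\Pi$. With $v_p'=(V_p,F_p,O_p)$ and risk preferences $\lambda_p,\lambda_c>0$, $$\Psi_p(v_p,E)=-E^\top V_p-\mathbb E^{\mathbb P}[G]^\top F_p-\mathbb E^{\mathbb P}[G_{em}]^\top O_p-\tfrac{\lambda_p}2 v_p'^\top\hat Qv_p',\qquad \Psi_c(V_c,E)=-E^\top V_c-\tfrac{\lambda_c}2V_c^\top\hat Q_1V_c,$$ $$\Psi_M(E,V)=E^\top\Big(\sum_{c\in C}V_c+\sum_{p\in P}V_p\Big),\qquad S_M=\{E\in\mathbb R^N: |e^{\hat rT_j}E(t_i,T_j)|\le\Pi_{max}\ \forall j\in J,i\in I_j\},$$ with a given (large) constant $\Pi_{max}>0$. Nash equilibrium: $v_p^*\in S_p$, $V_c^*\in S_c$, $E^*\in S_M$ such that each $v_p^*$ maximizes $\Psi_p(\cdot,E^* )$ over $S_p$, each $V_c^*$ maximizes $\Psi_c(\cdot,E^* )$ over $S_c$, and $E^*$ maximizes $\Psi_M(\cdot,V^*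 )$ over $S_M$, where $V^*$ collects all $V_p^*$ and $V_c^*$. Assumption (A): for every $p\in P$ there is $v_p$ satisfying all equality constraints of $S_p$ and all its inequality constraints strictly; for every $c\in C$ there is $V_c$ satisfying the equality constraints of $S_c$ and its inequality constraints strictly; and these can be chosen such that $\sum_{c}V_c(t_i,T_j)+\sum_pV_p(t_i,T_j)=0$ for all $j\in J$, $i\in I_j$. Assumption (B): none of the random variables among the entries of $\Pi$, $G$, $G_{em}$ can be written as a linear combination of the others a.s. Convention (K): $F_{trade},V_{trade},\Pi_{max}$ are chosen so large that optimal fuel and emission trading strategies satisfy $\|(F_p,O_p)\|\le M_1<F_{trade}$, and in every Nash equilibrium $|e^{\hat rT_j}E^*(t_i,T_j)|\le M_2<\Pi_{max}$ and $|V_k^*(t_i,T_j)|\le M_3<V_{trade}$ for all $i,j$ and all $k\in P\cup C$. Bounds: a plant $r\in R^{p,l}$ is at the upper (lower) bound at $T_j$ if for every $\epsilon>0$ the value $W_{p,l,r}(T_j)+\epsilon$ (resp. $W_{p,l,r}(T_j)-\epsilon$) is infeasible, i.e. no production schedule of that plant satisfying the ramping and capacity constraints takes that value at $T_j$. $\bar S_M\subset\mathbb R^N$ is the set of price vectors $E$ for which, in optimal decisions of the producers at $E$, the power plants are either all at the upper or all at the lower bound simultaneously for at least one delivery time $T_j$, $j\in J$. For $E\in\mathbb R^N\setminus\bar S_M$ the optimal volume $V_k$ (maximizing $\Psi_k(\cdot,E)$ over $S_k$) of each $k\in P\cup C$ is unique and depends on $E$ in a $\mathbb{PC}^\infty$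 way. $\mathbb{PC}^r$ functions: a continuous $f:S_1\to\mathbb R^N$ on an open set $S_1\subseteq\mathbb R^N$ is $\mathbb{PC}^r$ if for every $x\in S_1$ there are an open neighborhood $S_2\subseteq S_1$ of $x$ and finitely many $\mathbb C^r$ functions $f^i:S_2\to\mathbb R^N$, $i\in\mathcal I$ (selection functions at $x$), with $f(z)\in\{f^i(z):i\in\mathcal I\}$ for all $z\in S_2$. The selection function $f^i$ is essentially active at $x$ if $x\in\mathrm{cl}\,\mathrm{int}\{z\in S_2:f^i(z)=f(z)\}$; $\mathcal I^e(x)$ is the set of indices of essentially active selection functions at $x$. $\mathcal D$ denotes the Jacobian. For a (not necessarily symmetric) real square matrix $M$, $M\prec0$ means $y^\top My<0$ for all $y\neq0$. *)

(* Defs.v *)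
From HB Require Import structures.
From mathcomp Require Import all_boot all_order all_algebra.
From mathcomp Require Import all_classical all_reals all_analysis.

Set Implicit Arguments.
Unset Strict Implicit.
Unset Printing Implicit Defensive.

Import Order.TTheory GRing.Theory Num.Theory.
Import numFieldNormedType.Exports.

Local Open Scope classical_set_scope.
Local Open Scope ring_scope.

Section PiecewiseSmooth.
Context {R : realType}.

(* Meaningful for open S: since S is open, continuity and differentiability at
   the points of S do not depend on the values of f outside S. *)
Fixpoint Ck {U W : normedModType R} (k : nat) (S : set U) (f : U -> W) : Prop :=
  match k with
  | 0 => forall x, S x -> {for x, continuous f}
  | k'.+1 => (forall x, S x -> differentiable f x) /\
             (forall v, Ck k' S (fun x => 'D_v f x))
  end.

Definition Cinfty {U W : normedModType R} (S : set U) (f : U -> W) : Prop :=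
  forall k, Ck k S f.

Context {N : nat}.
Implicit Types (S : set 'rV[R]_N) (f : 'rV[R]_N -> 'rV[R]_N) (x : 'rV[R]_N).

(* (fs i)_(i < m) are selection functions, on the open neighbourhood S2 of x,
   for the function f on the open set S1. *)
Definition selection S1 f x S2 (m : nat)
    (fs : 'I_m -> 'rV[R]_N -> 'rV[R]_N) : Prop :=
  [/\ open S2, S2 x, S2 `<=` S1,
      forall i, Cinfty S2 (fs i) &
      forall z, S2 z -> exists i, f z = fs i z].

Definition PCinfty S1 f : Prop :=
  [/\ open S1, {within S1, continuous f} &
      forall x, S1 x -> exists S2 m (fs : 'I_m -> 'rV[R]_N -> 'rV[R]_N),
        selection S1 f x S2 fs].

Definition essentially_active f S2 (g : 'rV[R]_N -> 'rV[R]_N) x : Prop :=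
  closure (interior [set z | S2 z /\ g z = f z]) x.

(* [jacobian] acts on row vectors, so it is the transpose of the usual Jacobian
   matrix; the quadratic form below is unchanged by transposition. *)
Definition negdef (A : 'M[R]_N) : Prop :=
  forall y : 'rV[R]_N, y != 0 -> (y *m A *m y^T) 0 0 < 0.

Definition maximizes {X : Type} (S : set X) (f : X -> R) (x : X) : Prop :=
  S x /\ forall y, S y -> f y <= f x.

End PiecewiseSmooth.

Record market (R : realType) (d : measure_display) (Omega : measurableType d)
    (Pr : probability Omega R) := Market {
  producer : finType;
  consumer : finType;
  fuel : finType;
  nT : nat;
  trading : 'I_nT -> finType;           (* trading j is I_j *)
  plant : producer -> fuel -> finType;  (* plant p l is R^{p,l} *)
  Tdel : 'I_nT -> R;                 (* T_j *)
  rate : R;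
  Pi : forall j, trading j -> {RV Pr >-> R};
  G : fuel -> forall j, trading j -> {RV Pr >-> R};
  Gem : forall j, trading j -> {RV Pr >-> R};
  demand : 'I_nT -> R;
  share : consumer -> R;                (* p_c *)
  heat : forall p l, plant p l -> R;    (* c^{p,l,r} *)
  carbon : fuel -> R;                   (* g^l *)
  ramp_min : forall p l, plant p l -> R;
  ramp_max : forall p l, plant p l -> R;
  Wmax : forall p l, plant p l -> R;
  Ftrade : R;
  Vtrade : R;
  Pimax : R;
  risk_p : producer -> R;               (* lambda_p *)
  risk_c : consumer -> R;               (* lambda_c *)
  producer_nonempty : (0 < #|producer|)%N;
  consumer_nonempty : (0 < #|consumer|)%N;
  Pi_L2 : forall j (i : trading j), (Pi i : Omega -> R) \in Lfun Pr 2%:E;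
  G_L2 : forall l j (i : trading j), (G l i : Omega -> R) \in Lfun Pr 2%:E;
  Gem_L2 : forall j (i : trading j), (Gem i : Omega -> R) \in Lfun Pr 2%:E;
  share_itv : forall c, 0 <= share c <= 1;
  share_sum : \sum_c share c = 1;
  heat_gt0 : forall p l (r : plant p l), 0 < heat r;
  carbon_gt0 : forall l, 0 < carbon l;
  Ftrade_gt0 : 0 < Ftrade;
  Vtrade_gt0 : 0 < Vtrade;
  Pimax_gt0 : 0 < Pimax;
  risk_p_gt0 : forall p, 0 < risk_p p;
  risk_c_gt0 : forall c, 0 < risk_c c
}.

Arguments trading {R d Omega Pr} m _.
Arguments Tdel {R d Omega Pr} m _.
Arguments Pi {R d Omega Pr} m [j] _.
Arguments G {R d Omega Pr} m _ [j] _.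
Arguments Gem {R d Omega Pr} m [j] _.
Arguments heat {R d Omega Pr} m [p l] _.
Arguments ramp_min {R d Omega Pr} m [p l] _.
Arguments ramp_max {R d Omega Pr} m [p l] _.
Arguments Wmax {R d Omega Pr} m [p l] _.

Section Market.
Context {R : realType} {d : measure_display} {Omega : measurableType d}
  {Pr : probability Omega R}.
Variable M : market Pr.

(* The pairs (t_i, T_j), for j in J and i in I_j. *)
Definition trade : finType := {j : 'I_(nT M) & trading M j}.

(* This is N = \sum_j |I_j| (lemma card_tagged). *)
Definition dimN : nat := #|{: trade}|.

Definition at_trade (x : 'rV[R]_dimN) (k : trade) : R := x 0 (enum_rank k).

Definition at_time (x : 'rV[R]_dimN) (j : 'I_(nT M)) (i : trading M j) : R :=
  at_trade x (Tagged (trading M) i).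

Definition dot (x y : 'rV[R]_dimN) : R := \sum_k x 0 k * y 0 k.

(* Entries of the random vector (Pi, G, G_em), and of v_p' = (V_p, F_p, O_p). *)
Definition asset : finType := (trade + fuel M * trade + trade)%type.
Definition electricity (k : trade) : asset := inl (inl k).
Definition fuel_asset (l : fuel M) (k : trade) : asset := inl (inr (l, k)).
Definition emission (k : trade) : asset := inr k.

Definition discount (j : 'I_(nT M)) : R := expR (- (rate M * Tdel M j)).

Definition price (a : asset) : Omega -> R := fun w =>
  match a with
  | inl (inl k) => discount (tag k) * Pi M (tagged k) w
  | inl (inr (l, k)) => discount (tag k) * G M l (tagged k) w
  | inr k => discount (tag k) * Gem M (tagged k) w
  end.

Definition mean (a : asset) : R := fine 'E_Pr[price a].

(* The covariance matrix Q^. *)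
Definition Q (a b : asset) : R := fine (covariance Pr (price a) (price b)).

Record decision (p : producer M) := Decision {
  dV : 'rV[R]_dimN;
  dF : fuel M -> 'rV[R]_dimN;
  dO : 'rV[R]_dimN;
  dW : forall l, plant p l -> 'I_(nT M) -> R
}.

Definition position p (v : decision p) (a : asset) : R :=
  match a with
  | inl (inl k) => at_trade (dV v) k
  | inl (inr (l, k)) => at_trade (dF v l) k
  | inr k => at_trade (dO v) k
  end.

Definition producer_eqs p (v : decision p) : Prop :=
  [/\ forall j, - (\sum_(i : trading M j) at_time (dV v) i) =
                \sum_l \sum_(r : plant p l) dW v r j,
      forall j l, \sum_(r : plant p l) heat M r * dW v r j =
                  \sum_(i : trading M j) at_time (dF v l) i &
      \sum_j \sum_(i : trading M j) at_time (dO v) i =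
      \sum_j \sum_l \sum_(r : plant p l) carbon l * dW v r j].

(* Ramping and capacity constraints of one plant.  Here and below cmp is <=%R
   for the constraints themselves and <%R for their strict versions. *)
Definition schedule_ineqs (cmp : rel R) p l (r : plant p l)
    (w : 'I_(nT M) -> R) : Prop :=
  (forall j j' : 'I_(nT M), j' = j.+1 :> nat ->
     cmp (ramp_min M r) (w j' - w j) /\ cmp (w j' - w j) (ramp_max M r)) /\
  (forall j, cmp 0 (w j) /\ cmp (w j) (Wmax M r)).

Definition producer_ineqs (cmp : rel R) p (v : decision p) : Prop :=
  [/\ forall l (r : plant p l), schedule_ineqs cmp r (dW v r),
      forall l j (i : trading M j), cmp `|at_time (dF v l) i| (Ftrade M),
      forall j (i : trading M j), cmp `|at_time (dO v) i| (Ftrade M) &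
      forall j (i : trading M j), cmp `|at_time (dV v) i| (Vtrade M)].

Definition S_p p : set (decision p) :=
  [set v | producer_eqs v /\ producer_ineqs <=%R v].

Definition consumer_eqs (c : consumer M) (V : 'rV[R]_dimN) : Prop :=
  forall j, \sum_(i : trading M j) at_time V i = share c * demand j.

Definition consumer_ineqs (cmp : rel R) (V : 'rV[R]_dimN) : Prop :=
  forall j (i : trading M j), cmp `|at_time V i| (Vtrade M).

Definition S_c (c : consumer M) : set 'rV[R]_dimN :=
  [set V | consumer_eqs c V /\ consumer_ineqs <=%R V].

Definition S_M : set 'rV[R]_dimN :=
  [set E | forall j (i : trading M j),
     `|expR (rate M * Tdel M j) * at_time E i| <= Pimax M].

Definition Psi_p p (E : 'rV[R]_dimN) (v : decision p) : R :=
  - dot E (dV v)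
  - \sum_l \sum_k mean (fuel_asset l k) * at_trade (dF v l) k
  - \sum_k mean (emission k) * at_trade (dO v) k
  - risk_p p / 2 * \sum_a \sum_b position v a * Q a b * position v b.

Definition Psi_c (c : consumer M) (E V : 'rV[R]_dimN) : R :=
  - dot E V
  - risk_c c / 2 * \sum_k \sum_k'
      at_trade V k * Q (electricity k) (electricity k') * at_trade V k'.

Definition total_volume (v : forall p, decision p)
    (V : consumer M -> 'rV[R]_dimN) : 'rV[R]_dimN :=
  \sum_c V c + \sum_p dV (v p).

Definition Psi_M (v : forall p, decision p) (V : consumer M -> 'rV[R]_dimN)
    (E : 'rV[R]_dimN) : R :=
  dot E (total_volume v V).

Definition optimal_p p (E : 'rV[R]_dimN) (v : decision p) : Prop :=
  maximizes (@S_p p) (@Psi_p p E) v.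

Definition optimal_c (c : consumer M) (E V : 'rV[R]_dimN) : Prop :=
  maximizes (S_c c) (Psi_c c E) V.

Definition nash (v : forall p, decision p) (V : consumer M -> 'rV[R]_dimN)
    (E : 'rV[R]_dimN) : Prop :=
  [/\ forall p, optimal_p E (v p),
      forall c, optimal_c c E (V c) &
      maximizes S_M (Psi_M v V) E].

Definition assumptionA : Prop :=
  exists (v : forall p, decision p) (V : consumer M -> 'rV[R]_dimN),
    [/\ forall p, producer_eqs (v p) /\ producer_ineqs <%R (v p),
        forall c, consumer_eqs c (V c) /\ consumer_ineqs <%R (V c) &
        forall j (i : trading M j), at_time (total_volume v V) i = 0].

Definition assumptionB : Prop :=
  forall (a : asset) (beta : asset -> R),
    ~ {ae Pr, forall w, price a w = \sum_(b | b != a) beta b * price b w}.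

Definition norm_FO p (v : decision p) : R :=
  Num.sqrt (\sum_l \sum_k at_trade (dF v l) k ^+ 2 +
            \sum_k at_trade (dO v) k ^+ 2).

Definition conventionK : Prop :=
  exists M1 M2 M3 : R,
    [/\ M1 < Ftrade M, M2 < Pimax M, M3 < Vtrade M,
        forall E p (v : decision p), optimal_p E v -> norm_FO v <= M1 &
        forall v V E, nash v V E -> forall j (i : trading M j),
          [/\ `|expR (rate M * Tdel M j) * at_time E i| <= M2,
              forall p, `|at_time (dV (v p)) i| <= M3 &
              forall c, `|at_time (V c) i| <= M3]].

Definition feasible_value p l (r : plant p l) (j : 'I_(nT M)) (x : R) : Prop :=
  exists w, schedule_ineqs <=%R r w /\ w j = x.

Definition at_upper p (v : decision p) l (r : plant p l) j : Prop :=
  forall eps, 0 < eps -> ~ feasible_value r j (dW v r j + eps).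

Definition at_lower p (v : decision p) l (r : plant p l) j : Prop :=
  forall eps, 0 < eps -> ~ feasible_value r j (dW v r j - eps).

(* The set of prices is quantified over all optimal decisions of the producers
   at E.  When Q^ is positive definite, the optimal V_p is unique, hence so is
   the aggregate production of p at each T_j, and replacing "all" by "some"
   yields the same set. *)
Definition SbarM : set 'rV[R]_dimN :=
  [set E | forall v : forall p, decision p, (forall p, optimal_p E (v p)) ->
     exists j, (forall p l (r : plant p l), at_upper (v p) r j) \/
               (forall p l (r : plant p l), at_lower (v p) r j)].

(* Z is the PC^oo map sending E outside SbarM to the unique optimal volume. *)
Definition producer_volume_map p (Z : 'rV[R]_dimN -> 'rV[R]_dimN) : Prop :=
  PCinfty (~` SbarM) Z /\
  forall E, ~ SbarM E -> [set dV v | v in @optimal_p p E] = [set Z E].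

Definition consumer_volume_map c (Z : 'rV[R]_dimN -> 'rV[R]_dimN) : Prop :=
  PCinfty (~` SbarM) Z /\
  forall E, ~ SbarM E -> optimal_c c E = [set Z E].

End Market.

Arguments SbarM {R d Omega Pr} M _.

(* Main.v *)
Require Import Defs.
From mathcomp Require Import all_boot all_order all_algebra.
From mathcomp Require Import all_classical all_reals all_analysis.
From mathcomp Require Import ring lra.

Set Implicit Arguments.
Unset Strict Implicit.
Unset Printing Implicit Defensive.

Import Order.TTheory GRing.Theory Num.Theory.
Import numFieldNormedType.Exports.

Local Open Scope classical_set_scope.
Local Open Scope ring_scope.

(** Every payoff of a producer or consumer depends on the price vector [E] only
    through the linear term [- E . V], and this drives the proof.

    Let two equilibria be given, with prices [E1] and [E2].  Equilibrium prices
    are interior points of the price box, so the market agent can only be at an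
    optimum if the total traded volume vanishes ([nash_total_volume]).
    Revealed preference makes each player's demand monotone in the price:
    [0 <= (E2 - E1) . (V1 - V2)] ([optimal_volume_monotone]).  These numbers add
    up to zero over the players, because both total volumes vanish; hence each
    of them is zero, which means that the decisions of the first equilibrium
    are still optimal at [E2] ([nash_exchange]).  Payoffs being affine in the
    price, they are then optimal on the whole segment from [E1] to [E2]
    ([optimal_segment]).

    Along this segment the optimal total volume is therefore constantly zero.
    No price of the segment lies in [SbarM M]: in a balanced market the total
    production at each delivery time equals the demand, just as in the strictly
    feasible point of assumption (A), whereas a plant at its upper (lower) bound
    produces strictly more (less) than in that point
    ([balanced_notin_SbarM]).  So [Z] vanishes on the segment.

    This contradicts negative definiteness if [E1 <> E2]: near [E1] the map [Z]
    agrees at each point with some selection function that is essentially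
    active at [E1] ([near_essentially_active]), each of these has a nonzero
    derivative in the direction [E2 - E1], and thus [Z] cannot take the value
    zero at points of the line that are close to but distinct from [E1]
    ([piecewise_isolates]).

    The comparison of production levels needs at least one plant.  Without
    plants, producers sell nothing on balance and the prices for one delivery
    time can be raised uniformly until one of them reaches the bound of the box
    without destroying the equilibrium, which convention (K) excludes
    ([nash_has_plant]). *)

(** * Piecewise smooth maps with negative definite Jacobians *)

(** A finite version of the Baire category theorem, hence valid in every
    topological space: peel off the sets one by one, each time passing to the
    open set that is left. *)
Lemma finite_cover_interior (T : topologicalType) (I : eqType)
    (A : I -> set T) (s : seq I) (V : set T) :
  V !=set0 -> open V ->
  (forall i z, V z -> ~ A i z -> \forall w \near z, ~ A i w) ->
  (forall z, V z -> exists2 i, i \in s & A i z) ->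
  exists i, V `&` interior (A i) !=set0.
Proof.
elim: s V => [|i s IHs] V [z Vz] Vopen Aclosed Vcover.
  by case: (Vcover z Vz).
have [VA|/existsNP[w /not_implyP[Vw Aiw]]] := pselect (V `<=` A i).
  by exists i, z; split=> //; apply: filterS VA _; exact: open_nbhs_nbhs.
have [j [u [[Vu _] Aju]]] : exists j,
    (V `&` interior (~` A i)) `&` interior (A j) !=set0.
  apply: IHs.
  - by exists w; split=> //; apply: Aclosed.
  - exact: openI Vopen (open_interior _).
  - by move=> j u [Vu _]; apply: Aclosed.
  - move=> u [Vu /interior_subset Aiu]; have [j] := Vcover u Vu.
    by rewrite inE => /orP[/eqP->//|js Aju]; exists j.
by exists j, u.
Qed.

Lemma nbhs_neq (T : topologicalType) (R : realType) (W : normedModType R)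
    (f g : T -> W) (z : T) :
  {for z, continuous f} -> {for z, continuous g} -> f z <> g z ->
  \forall w \near z, f w <> g w.
Proof.
move=> fz gz fgz.
have fg0 : f z - g z != 0 by rewrite subr_eq0; apply/eqP.
have fg : (f - g) w @[w --> z] --> f z - g z by exact: cvgB.
have : \forall w \near z, (f - g) w != 0 by exact: cvgr_neq0 fg fg0.
by apply: filterS => w; rewrite subr_eq0 => /eqP.
Qed.

(** The difference quotients at [x] stay away from zero when their limit is
    nonzero.  The value [c] is arbitrary because continuity alone settles the
    case [f x <> c]. *)
Lemma derivative_isolates (R : realType) (U W : normedModType R) (f : U -> W)
    (x h : U) (c : W) :
  differentiable f x -> 'D_h f x != 0 ->
  \forall t \near 0^', f (t *: h + x) != c.
Proof.
move=> df Dh.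
have [<-|fxc] := eqVneq (f x) c; last first.
  have lc : {for (0 : R), continuous (fun t : R => t *: h + x)}.
    by apply: cvgD; [apply: cvgZl; exact: cvg_id|exact: cvg_cst].
  apply: (@cvg_within _ (nbhs (0 : R))).
  have fc : {for (0 : R), continuous (fun t : R => f (t *: h + x))}.
    apply: (@continuous_comp _ _ _ (fun t : R => t *: h + x) f) => //.
    by rewrite scale0r add0r; exact: differentiable_continuous.
  have : \forall t \near (0 : R), f (t *: h + x) <> c.
    apply: (@nbhs_neq _ _ _ (fun t : R => f (t *: h + x)) (fun=> c)) => //.
      exact: cvg_cst.
    by rewrite scale0r add0r; exact/eqP.
  by apply: filterS => t /eqP.
have : \forall t \near 0^', t^-1 *: (f (t *: h + x) - f x) != 0.
  exact: cvgr_neq0 (@diff_derivable _ _ _ _ _ h df) Dh.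
by apply: filterS => t; apply: contra_neq => fE; rewrite fE subrr scaler0.
Qed.

Lemma continuous_sum (R : realType) (T : topologicalType) (W : normedModType R)
    (I : finType) (F : I -> T -> W) (z : T) :
  (forall i, {for z, continuous (F i)}) ->
  {for z, continuous (fun x => \sum_i F i x)}.
Proof.
move=> Fc; apply: (cvg_big _ (nbhs_filter z)) => [|i _]; last exact: Fc.
exact: add_continuous.
Qed.

Section PiecewiseSmooth.
Context {R : realType} {N : nat}.
Implicit Types (f : 'rV[R]_N -> 'rV[R]_N) (x h : 'rV[R]_N) (S : set 'rV[R]_N).

(** Selection functions that are not essentially active at [x] coincide with
    [f] on closed sets without interior near [x].  Finitely many such sets
    cannot cover a nonempty open set, so the points near [x] where an active
    selection function coincides with [f] are dense, and by continuity they are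
    all the points near [x]. *)
Lemma near_essentially_active S f x S2 (m : nat)
    (fs : 'I_m -> 'rV[R]_N -> 'rV[R]_N) :
  (forall z, S z -> {for z, continuous f}) -> selection S f x S2 fs ->
  \forall z \near x, exists i, essentially_active f S2 (fs i) x /\ f z = fs i z.
Proof.
move=> fc [S2open S2x S2S smooth sel].
pose A i := [set z | S2 z /\ fs i z = f z].
have S2near : \forall z \near x, S2 z by exact: open_nbhs_nbhs.
have nearact : \forall z \near x,
    forall i, ~ essentially_active f S2 (fs i) x -> ~ interior (A i) z.
  apply: (@filter_forall _ 'I_m _ _ (nbhs_filter x)) => i.
  have [ai|nai] := pselect (essentially_active f S2 (fs i) x).
    by apply: nearW => z /(_ ai).
  have : interior (~` interior (A i)) x by rewrite interiorC.
  by apply: filterS => z.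
apply: (@filterS _ _ (nbhs_filter x) _ _ _
  (nbhs_interior (@filterI _ _ (nbhs_filter x) _ _ S2near nearact))) => z Uz.
(* If no active selection agrees with [f] at [z], this persists on an open
   neighborhood of [z], which the other selections would have to cover. *)
apply: contrapT => /forallNP noactive.
have contf w : S2 w -> {for w, continuous f} by move=> /S2S /fc.
have contfs i w : S2 w -> {for w, continuous (fs i)}.
  by move=> S2w; exact: (smooth i 0%N).
pose B := [set w | forall i, essentially_active f S2 (fs i) x -> fs i w <> f w].
pose U := [set z | S2 z /\
  forall i, ~ essentially_active f S2 (fs i) x -> ~ interior (A i) z].
have [] := @finite_cover_interior _ 'I_m A (enum 'I_m)
    (interior U `&` interior B).
- exists z; split=> //.
  apply: (@filter_forall _ 'I_m _ _ (nbhs_filter z)) => i.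
  have [ai|nai] := pselect (essentially_active f S2 (fs i) x); last first.
    by apply: nearW => w /nai.
  have S2z : S2 z by have [] := interior_subset Uz.
  have : \forall w \near z, fs i w <> f w.
    apply: nbhs_neq; [exact: contfs|exact: contf|].
    by move=> fE; apply: (noactive i).
  by apply: filterS => w ?.
- by apply: openI; exact: open_interior.
- move=> i w [/interior_subset[S2w _] _] nAw.
  have : \forall w' \near w, fs i w' <> f w'.
    by apply: nbhs_neq; [exact: contfs|exact: contf|move=> E; exact: nAw].
  by apply: filterS => w' ne [].
- move=> w [/interior_subset[S2w _] _]; have [i fE] := sel w S2w.
  by exists i; rewrite ?mem_enum.
move=> i [w [[/interior_subset[_ Uw] /interior_subset Bw] Aiw]].
have [/Bw|/Uw] := pselect (essentially_active f S2 (fs i) x); last by [].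
by have [_] := interior_subset Aiw.
Qed.

(** A direction in the kernel of a matrix makes its quadratic form vanish, so no
    essentially active selection function has derivative zero along [h]; near
    [x], all values of [f] are values of such functions. *)
Lemma piecewise_isolates S f x S2 (m : nat)
    (fs : 'I_m -> 'rV[R]_N -> 'rV[R]_N) h c :
  (forall z, S z -> {for z, continuous f}) -> selection S f x S2 fs ->
  (forall i, essentially_active f S2 (fs i) x -> negdef (jacobian (fs i) x)) ->
  h != 0 -> \forall t \near 0^', f (t *: h + x) != c.
Proof.
move=> fc sel neg h0.
have [_ S2x _ smooth _] := sel.
have lc : t *: h + x @[t --> (0 : R)] --> x.
  rewrite -[in X in _ --> X](add0r x) -(scale0r h).
  by apply: cvgD; [apply: cvgZl; exact: cvg_id|exact: cvg_cst].
have Hact : \forall t \near 0^', exists i,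
    essentially_active f S2 (fs i) x /\ f (t *: h + x) = fs i (t *: h + x).
  apply: (@cvg_within _ (nbhs (0 : R))).
  exact: lc (near_essentially_active fc sel).
have Hne : \forall t \near 0^', forall i,
    essentially_active f S2 (fs i) x -> fs i (t *: h + x) != c.
  apply: filter_forall => i.
  have [ai|nai] := pselect (essentially_active f S2 (fs i) x); last first.
    by apply: nearW => t /nai.
  have df : differentiable (fs i) x by have [/(_ x S2x)] := smooth i 1%N.
  have Dh : 'D_h (fs i) x != 0.
    apply/eqP; rewrite deriveEjacobian// => D0.
    by have := neg i ai h h0; rewrite D0 mul0mx mxE ltxx.
  by have := @derivative_isolates R _ _ (fs i) x h c df Dh; apply: filterS.
apply: filterS2 Hact Hne => t [i [ai ->]] Hne; exact: Hne.
Qed.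

End PiecewiseSmooth.

(** * Optimal decisions of price takers *)

Section Market.
Context {R : realType} {d : measure_display} {Omega : measurableType d}
  {Pr : probability Omega R} {M : market Pr}.
Local Notation volume := 'rV[R]_(dimN M).
Implicit Types (E V : volume) (j : 'I_(nT M)).

Lemma dotBl E E' V : dot (E - E') V = dot E V - dot E' V.
Proof. by rewrite -sumrB; apply: eq_bigr => k _; rewrite !mxE mulrBl. Qed.

Lemma dotDl E E' V : dot (E + E') V = dot E V + dot E' V.
Proof. by rewrite -big_split; apply: eq_bigr => k _; rewrite !mxE mulrDl. Qed.

Lemma dotZl a E V : dot (a *: E) V = a * dot E V.
Proof. by rewrite mulr_sumr; apply: eq_bigr => k _; rewrite mxE mulrA. Qed.

Lemma dotDr E V V' : dot E (V + V') = dot E V + dot E V'.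
Proof. by rewrite -big_split; apply: eq_bigr => k _; rewrite !mxE mulrDr. Qed.

Lemma dotBr E V V' : dot E (V - V') = dot E V - dot E V'.
Proof. by rewrite -sumrB; apply: eq_bigr => k _; rewrite !mxE mulrBr. Qed.

Lemma dotv0 E : dot E (0 : volume) = 0.
Proof. by rewrite /dot big1// => k _; rewrite mxE mulr0. Qed.

Lemma dot_sumr E (I : finType) (V : I -> volume) :
  dot E (\sum_i V i) = \sum_i dot E (V i).
Proof.
rewrite exchange_big; apply: eq_bigr => k _.
by rewrite summxE mulr_sumr.
Qed.

Section PriceTaking.
Context {X : Type} (S : set X) (vol : X -> volume) (Psi : volume -> X -> R).

(** The price enters the payoff through [- E . vol x] only.  Stating this by
    differences avoids a name for the price-independent part of the payoff. *)
Definition price_taking :=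
  forall E E' x, Psi E' x = Psi E x - dot (E' - E) (vol x).
Hypothesis PsiE : price_taking.

(** Revealed preference: add the two optimality inequalities that compare [x1]
    with [x2]. *)
Lemma optimal_volume_monotone E1 E2 x1 x2 :
  maximizes S (Psi E1) x1 -> maximizes S (Psi E2) x2 ->
  0 <= dot (E2 - E1) (vol x1 - vol x2).
Proof.
move=> [S1 opt1] [S2 opt2]; have := opt1 _ S2; have := opt2 _ S1.
by rewrite !(PsiE E1 E2) dotBr; lra.
Qed.

(** In the equality case of [optimal_volume_monotone] both optimality
    inequalities are equalities. *)
Lemma optimal_swap E1 E2 x1 x2 :
  maximizes S (Psi E1) x1 -> maximizes S (Psi E2) x2 ->
  dot (E2 - E1) (vol x1 - vol x2) = 0 -> maximizes S (Psi E2) x1.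
Proof.
move=> [S1 opt1] [S2 opt2]; rewrite dotBr => d0; split=> // y Sy.
apply: le_trans (opt2 _ Sy) _; have := opt1 _ S2.
by rewrite !(PsiE E1 E2); lra.
Qed.

(** The payoff at a price between [E1] and [E2] is the convex combination of
    the payoffs at [E1] and [E2]. *)
Lemma optimal_segment E1 E2 x t : 0 <= t <= 1 ->
  maximizes S (Psi E1) x -> maximizes S (Psi E2) x ->
  maximizes S (Psi (t *: (E2 - E1) + E1)) x.
Proof.
move=> /andP[t0 t1] [Sx opt1] [_ opt2]; split=> // y Sy.
have conv z : Psi (t *: (E2 - E1) + E1) z = (1 - t) * Psi E1 z + t * Psi E2 z.
  rewrite (PsiE E1 (t *: _ + _)) addrK dotZl (PsiE E1 E2); ring.
rewrite !conv lerD// ler_wpM2l ?subr_ge0//; [exact: opt1|exact: opt2].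
Qed.

(** A price change that costs the same for all feasible decisions does not
    affect optimality. *)
Lemma optimal_shift E D x : (forall y, S y -> dot D (vol y) = dot D (vol x)) ->
  maximizes S (Psi E) x -> maximizes S (Psi (E + D)) x.
Proof.
move=> Dc [Sx opt]; split=> // y Sy.
by rewrite !(PsiE E (E + D)) addrAC subrr add0r Dc// lerB// opt.
Qed.

End PriceTaking.

Lemma Psi_p_price_taking p :
  price_taking (@dV _ _ _ _ M p) (@Psi_p _ _ _ _ M p).
Proof. by move=> E E' v; rewrite /Psi_p dotBl; ring. Qed.

Lemma Psi_c_price_taking c : price_taking id (@Psi_c _ _ _ _ M c).
Proof. by move=> E E' V; rewrite /Psi_c dotBl /=; ring. Qed.

(** * Equilibria balance the market *)

(** The price increase by one unit at all trading times for delivery at [T_j];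
    pairing with it sums up the volumes delivered at [T_j]. *)
Definition flat_price j : volume := \row_k (tag (enum_val k) == j)%:R.

Lemma dot_flat_price j V :
  dot (flat_price j) V = \sum_(i : trading M j) at_time V i.
Proof.
rewrite /dot (reindex (@enum_rank (trade M))) /=; last first.
  exact/onW_bij/enum_rank_bij.
under eq_bigr do rewrite mxE enum_rankK.
rewrite [RHS]big_mkcond /=.
transitivity (\sum_(j' : 'I_(nT M)) \sum_(i : trading M j')
   (j' == j)%:R * at_time V i).
  rewrite (sig_big_dep xpredT (fun _ _ => true)
    (fun j' (i : trading M j') => (j' == j)%:R * at_time V i)) /=.
  by apply: eq_bigr => -[j' i].
rewrite (bigD1 j)//= eqxx [X in _ + X]big1 ?addr0; last first.
  by move=> j' /negPf ->; rewrite big1// => i _; rewrite mul0r.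
by apply: eq_bigr => i _; rewrite mul1r.
Qed.

(** What producers generate is what they sell, and what consumers buy covers
    the demand because the shares add up to one. *)
Lemma production_balance (v : forall p : producer M, decision p)
    (V : consumer M -> volume) j :
  (forall p, producer_eqs (v p)) -> (forall c, consumer_eqs c (V c)) ->
  total_volume v V = 0 ->
  \sum_p \sum_l \sum_(r : plant p l) dW (v p) r j = demand j.
Proof.
move=> vE VE tot0.
have := congr1 (dot (flat_price j)) tot0.
rewrite dotv0 dotDr !dot_sumr.
under eq_bigr do rewrite dot_flat_price VE.
rewrite -mulr_suml share_sum mul1r.
under eq_bigr do rewrite dot_flat_price.
move=> /eqP; rewrite addr_eq0 => /eqP ->.
rewrite -sumrN; apply: eq_bigr => p _.
by have [/(_ j) <- _ _] := vE p.
Qed.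

(** The market agent maximizes a linear form over a box at an interior point,
    so this form is zero: a small move of one price in either direction must
    not be profitable. *)
Lemma nash_total_volume (v : forall p : producer M, decision p)
    (V : consumer M -> volume) E :
  conventionK M -> nash v V E -> total_volume v V = 0.
Proof.
move=> [M1 [M2 [M3 [_ M2lt _ _ Kint]]]] nashE.
have [_ _ [SME optE]] := nashE.
have unit_dot k a V' : dot (a *: delta_mx 0 k) V' = a * V' 0 k.
  rewrite dotZl /dot (bigD1 k)//= mxE !eqxx mul1r big1 ?addr0// => k' k'k.
  by rewrite mxE (negPf k'k) andbF mul0r.
apply/rowP => k; rewrite [RHS]mxE.
pose c := expR (rate M * Tdel M (tag (enum_val k))).
have c0 : 0 < c := expR_gt0 _.
have opt a : c * `|a| <= Pimax M - M2 -> a * total_volume v V 0 k <= 0.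
  move=> ca; have := optE (E + a *: delta_mx 0 k).
  rewrite /Psi_M dotDl unit_dot gerDl; apply=> j i.
  have [M2E _ _] := Kint _ _ _ nashE j i.
  rewrite /at_time /at_trade !mxE eqxx /= mulrDr.
  apply: le_trans (ler_normD _ _) _.
  have -> : Pimax M = M2 + (Pimax M - M2) by ring.
  apply: lerD => //; rewrite normrM gtr0_norm ?expR_gt0//.
  have [kE|_] := eqVneq; last by rewrite mulr0 normr0 mulr0 subr_ge0 ltW.
  by move: ca; rewrite /c -kE enum_rankK mulr1.
(* The discounted distance from the price to the bound that is left by
   convention (K). *)
have e0 : 0 < (Pimax M - M2) / c by rewrite divr_gt0// subr_gt0.
have ce : c * ((Pimax M - M2) / c) = Pimax M - M2 by field; rewrite gt_eqF.
apply/eqP; rewrite eq_le -(pmulr_rle0 _ e0) opt; last first.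
  by rewrite gtr0_norm// ce.
rewrite -oppr_le0 -(pmulr_rle0 _ e0) mulrN -mulNr opt//.
by rewrite normrN gtr0_norm// ce.
Qed.

Lemma producer_sold p (v : decision p) j :
  S_p v -> dot (flat_price j) (dV v) = - \sum_l \sum_(r : plant p l) dW v r j.
Proof. by move=> [[/(_ j) <- _ _] _]; rewrite opprK dot_flat_price. Qed.

(** Without plants every player's volume at a delivery time is fixed by the
    constraints, so raising all prices for this delivery time by the same amount
    keeps the equilibrium.  Raise them until the highest one reaches [Pimax M]:
    this contradicts the bound on equilibrium prices in convention (K). *)
Lemma nash_has_plant (v : forall p : producer M, decision p)
    (V : consumer M -> volume) E (k : trade M) :
  conventionK M -> nash v V E ->
  exists p l, inhabited (plant (m := M) p l).
Proof.
move=> hK nashE; apply: contrapT => noplant.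
have tot0 := nash_total_volume hK nashE.
have [M1 [M2 [M3 [_ M2lt _ _ Kint]]]] := hK.
have [optp optc [SME _]] := nashE.
have noprod p (v' : decision p) j : \sum_l \sum_(r : plant p l) dW v' r j = 0.
  rewrite big1// => l _; rewrite big1// => r _.
  by case: noplant; exists p, l; constructor.
case: k => j i0.
pose c := expR (rate M * Tdel M j).
have c0 : 0 < c := expR_gt0 _.
have [i1 _ i1max] := @arg_maxP _ _ _ i0 xpredT (fun i => at_time E i) isT.
(* The amount by which the highest price [at_time E i1] misses the bound. *)
pose a := Pimax M / c - at_time E i1.
have peakE : c * (at_time E i1 + a) = Pimax M.
  by rewrite addrC subrK mulrCA divff ?gt_eqF// mulr1.
have at_shift (i : trading M j) :
    at_time (E + a *: flat_price j) i = at_time E i + a.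
  by rewrite /at_time /at_trade !mxE enum_rankK /= eqxx mulr1.
have nash' : nash v V (E + a *: flat_price j).
  split.
  - move=> p.
    apply: (optimal_shift (@Psi_p_price_taking p) _ (optp p)) => v' Sv'.
    have Sv : S_p (v p) by have [] := optp p.
    by rewrite !dotZl !producer_sold// !noprod.
  - move=> e.
    apply: (optimal_shift (@Psi_c_price_taking e) _ (optc e)) => V' SV'.
    have [VE _] : S_c e (V e) by have [] := optc e.
    by rewrite !dotZl !dot_flat_price VE; case: SV' => ->.
  - split; last by move=> E' _; rewrite /Psi_M tot0 !dotv0.
    move=> j' i; have [jj'|jj'] := eqVneq j' j; last first.
      rewrite /at_time /at_trade !mxE enum_rankK /= (negPf jj') mulr0 addr0.
      exact: SME.
    subst j'; rewrite at_shift ler_norml.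
    have := SME _ i; rewrite ler_norml -/c => /andP[lo _].
    have [hi _ _] := Kint _ _ _ nashE j i1.
    have := i1max i isT => /= iE.
    have a0 : 0 <= a.
      rewrite subr_ge0 ler_pdivlMr// mulrC.
      by apply: le_trans (ler_norm _) _; apply: le_trans hi (ltW _).
    apply/andP; split.
      by apply: le_trans lo _; rewrite ler_pM2l// lerDl.
    by rewrite -peakE ler_pM2l// lerD2r.
have [] := Kint _ _ _ nash' j i1.
by rewrite at_shift -/c peakE gtr0_norm ?Pimax_gt0// leNgt M2lt.
Qed.

(** * Balanced markets avoid simultaneous saturation *)

(** Changing the production at the single time [T_j] violates none of the
    finitely many strict constraints if the change is small. *)
Lemma strict_schedule_perturb p l (r : plant (m := M) p l)
    (w : 'I_(nT M) -> R) j : schedule_ineqs <%R r w ->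
  exists eps, [/\ 0 < eps, feasible_value r j (w j + eps) &
                  feasible_value r j (w j - eps)].
Proof.
move=> [ramp cap].
have slack (a b u : R) : a < b -> \forall e \near (0 : R), a <= b + e * u.
  move=> ab.
  have bu : b + e * u @[e --> (0 : R)] --> b.
    rewrite -[X in _ --> X]addr0 -[X in _ --> b + X](mul0r u).
    apply: cvgD; first exact: cvg_cst.
    by apply: cvgM; [exact: cvg_id|exact: cvg_cst].
  have : \forall e \near (0 : R), a < b + e * u by exact: cvgr_gt bu _ ab.
  by apply: filterS => e /ltW.
pose w' e := fun k => w k + e * (k == j)%:R.
have nearw : \forall e \near (0 : R), schedule_ineqs <=%R r (w' e).
  have nramp : \forall e \near (0 : R), forall j1 j2 : 'I_(nT M),
      j2 = j1.+1 :> nat ->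
      ramp_min M r <= w' e j2 - w' e j1 /\ w' e j2 - w' e j1 <= ramp_max M r.
    apply: (@filter_forall _ 'I_(nT M) _ _ (nbhs_filter (0 : R))) => j1.
    apply: (@filter_forall _ 'I_(nT M) _ _ (nbhs_filter (0 : R))) => j2.
    have [j12|nj12] := eqVneq (j2 : nat) j1.+1; last first.
      by apply: nearW => e jE; rewrite jE eqxx in nj12.
    have [lo hi] := ramp _ _ j12.
    have := slack _ _ ((j1 == j)%:R - (j2 == j)%:R) hi.
    have := slack _ _ ((j2 == j)%:R - (j1 == j)%:R) lo.
    by apply: filterS2 => e; rewrite /w' => ? ? _; lra.
  have ncap : \forall e \near (0 : R), forall k,
      0 <= w' e k /\ w' e k <= Wmax M r.
    apply: (@filter_forall _ 'I_(nT M) _ _ (nbhs_filter (0 : R))) => k.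
    have [lo hi] := cap k.
    have := slack _ _ (- (k == j)%:R) hi; have := slack _ _ (k == j)%:R lo.
    by apply: filterS2 => e; rewrite /w' => ? ?; lra.
  by apply: filterS2 nramp ncap => e; exact: conj.
have [eps /= eps0 epsP] := nearw.
have half0 : 0 < eps / 2 by rewrite divr_gt0.
exists (eps / 2); split=> //.
- exists (w' (eps / 2)); rewrite /w' eqxx mulr1; split=> //.
  by apply: epsP; rewrite /= sub0r normrN gtr0_norm//; lra.
- exists (w' (- (eps / 2))); rewrite /w' eqxx mulr1; split=> //.
  by apply: epsP; rewrite /= sub0r opprK gtr0_norm//; lra.
Qed.

(** A plant that produces at most [w j] at [T_j] can produce more, because by
    [strict_schedule_perturb] some amount above [w j] is feasible. *)
Lemma at_upper_gt_strict p (v : decision p) l (r : plant p l)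
    (w : 'I_(nT M) -> R) j :
  schedule_ineqs <%R r w -> at_upper v r j -> w j < dW v r j.
Proof.
move=> /strict_schedule_perturb-/(_ j)[eps [eps0 fe _]] up.
rewrite ltNge; apply/negP => vw.
apply: (up (w j + eps - dW v r j)); first lra.
by rewrite addrC subrK.
Qed.

Lemma at_lower_lt_strict p (v : decision p) l (r : plant p l)
    (w : 'I_(nT M) -> R) j :
  schedule_ineqs <%R r w -> at_lower v r j -> dW v r j < w j.
Proof.
move=> /strict_schedule_perturb-/(_ j)[eps [eps0 _ fe]] low.
rewrite ltNge; apply/negP => vw.
apply: (low (dW v r j - (w j - eps))); first lra.
by rewrite opprB addrC subrK.
Qed.

Lemma ltr_sum_one (I : finType) (F G : I -> R) i :
  (forall k, F k <= G k) -> F i < G i -> \sum_k F k < \sum_k G k.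
Proof.
move=> FG Fi; rewrite (bigD1 i)//= [ltRHS](bigD1 i)//= ltr_leD//.
by apply: ler_sum => k _.
Qed.

Lemma sum_plants_lt (f g : forall p l, plant (m := M) p l -> R) :
  (exists p l, inhabited (plant (m := M) p l)) ->
  (forall p l r, f p l r < g p l r) ->
  \sum_p \sum_l \sum_(r : plant p l) f p l r <
  \sum_p \sum_l \sum_(r : plant p l) g p l r.
Proof.
move=> [p0 [l0 [r0]]] fg.
apply: (ltr_sum_one (i := p0)) => [p|].
  by apply: ler_sum => l _; apply: ler_sum => r _; exact: ltW.
apply: (ltr_sum_one (i := l0)) => [l|].
  by apply: ler_sum => r _; exact: ltW.
by apply: (ltr_sum_one (i := r0)) => [r|]; [exact: ltW|exact: fg].
Qed.

(** Total production at [T_j] equals the demand both for [v] and for the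
    strictly feasible point of assumption (A); if all plants were at the same
    bound in [v], all of them would deviate from the strictly feasible point in
    the same direction. *)
Lemma balanced_notin_SbarM (v : forall p : producer M, decision p)
    (V : consumer M -> volume) E :
  assumptionA M ->
  (exists p l, inhabited (plant (m := M) p l)) ->
  (forall p, optimal_p E (v p)) -> (forall c, consumer_eqs c (V c)) ->
  total_volume v V = 0 -> ~ SbarM M E.
Proof.
move=> [vA [VA [vAP VAP totA]]] hplant optv VE tot0 /(_ _ optv)[j sat].
have prod : \sum_p \sum_l \sum_(r : plant p l) dW (v p) r j =
            \sum_p \sum_l \sum_(r : plant p l) dW (vA p) r j.
  rewrite (production_balance _ _ VE)//; last by move=> p; have [[]] := optv p.
  rewrite (@production_balance _ VA)//.
  - by move=> p; have [] := vAP p.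
  - by move=> c; have [] := VAP c.
  apply/rowP => k; rewrite [RHS]mxE -[k]enum_valK.
  by case: (enum_val k) => j' i; exact: totA.
have schedA p l (r : plant p l) : schedule_ineqs <%R r (dW (vA p) r).
  by have [_ [/(_ l r)]] := vAP p.
case: sat => sat.
- have := sum_plants_lt hplant
    (fun p l r => at_upper_gt_strict (schedA p l r) (sat p l r)).
  by rewrite prod ltxx.
- have := sum_plants_lt hplant
    (fun p l r => at_lower_lt_strict (schedA p l r) (sat p l r)).
  by rewrite prod ltxx.
Qed.

(** * Uniqueness of the equilibrium price *)

(** The inner products of [optimal_volume_monotone] are nonnegative and add up
    to zero over all players, since total volumes vanish in both equilibria; so
    the equality case [optimal_swap] applies to every player. *)
Lemma nash_exchange (v1 v2 : forall p : producer M, decision p)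
    (V1 V2 : consumer M -> volume) E1 E2 :
  conventionK M -> nash v1 V1 E1 -> nash v2 V2 E2 ->
  (forall p, optimal_p E2 (v1 p)) /\ (forall c, optimal_c c E2 (V1 c)).
Proof.
move=> hK nash1 nash2.
have [optp1 optc1 _] := nash1; have [optp2 optc2 _] := nash2.
have monp p := optimal_volume_monotone (@Psi_p_price_taking p)
  (optp1 p) (optp2 p).
have monc c := optimal_volume_monotone (@Psi_c_price_taking c)
  (optc1 c) (optc2 c).
have : \sum_c dot (E2 - E1) (V1 c - V2 c) +
       \sum_p dot (E2 - E1) (dV (v1 p) - dV (v2 p)) = 0.
  rewrite -!dot_sumr -dotDr !sumrB addrACA -opprD.
  rewrite -/(total_volume v1 V1) -/(total_volume v2 V2).
  rewrite (nash_total_volume hK nash1) (nash_total_volume hK nash2).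
  by rewrite subr0 dotv0.
have sumc_ge0 : 0 <= \sum_c dot (E2 - E1) (V1 c - V2 c) by exact: sumr_ge0.
have sump_ge0 : 0 <= \sum_p dot (E2 - E1) (dV (v1 p) - dV (v2 p)).
  exact: sumr_ge0.
move=> /eqP; rewrite paddr_eq0//.
move=> /andP[/eqP sumc0 /eqP sump0].
split=> [p|c].
- apply: (optimal_swap (@Psi_p_price_taking p) (optp1 p) (optp2 p)).
  by apply: (psumr_eq0P _ sump0) => // q _; exact: monp.
- apply: (optimal_swap (@Psi_c_price_taking c) (optc1 c) (optc2 c)).
  by apply: (psumr_eq0P _ sumc0) => // e _; exact: monc.
Qed.

End Market.

Theorem theorem3p22 (R : realType) (d : measure_display)
  (Omega : measurableType d) (Pr : probability Omega R) (M : market Pr)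
  (hA : assumptionA M) (hB : assumptionB M) (hK : conventionK M)
  (Zp : producer M -> 'rV[R]_(dimN M) -> 'rV[R]_(dimN M))
  (Zc : consumer M -> 'rV[R]_(dimN M) -> 'rV[R]_(dimN M))
  (hZp : forall p, producer_volume_map p (Zp p))
  (hZc : forall c, consumer_volume_map c (Zc c))
  (Z : 'rV[R]_(dimN M) -> 'rV[R]_(dimN M))
  (hZ : forall E, Z E = \sum_p Zp p E + \sum_c Zc c E)
  (* at each x, the selection functions of Z at x and their domain *)
  (S2 : 'rV[R]_(dimN M) -> set 'rV[R]_(dimN M))
  (m : 'rV[R]_(dimN M) -> nat)
  (Zi : forall x, 'I_(m x) -> 'rV[R]_(dimN M) -> 'rV[R]_(dimN M))
  (hZi : forall x, ~ SbarM M x -> selection (~` SbarM M) Z x (S2 x) (Zi x))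
  (hneg : forall x, ~ SbarM M x -> forall i : 'I_(m x),
     essentially_active Z (S2 x) (Zi x i) x -> negdef (jacobian (Zi x i) x)) :
  forall (v1 v2 : forall p, decision p) (V1 V2 : consumer M -> 'rV[R]_(dimN M))
    (E1 E2 : 'rV[R]_(dimN M)),
    nash v1 V1 E1 -> nash v2 V2 E2 -> E1 = E2.
Proof.
move=> v1 v2 V1 V2 E1 E2 nash1 nash2; apply: contrapT => /eqP E12.
have h0 : E2 - E1 != 0 by rewrite subr_eq0 eq_sym.
(* The index [k] certifies that something is traded, without which there may
   be no plant. *)
have [k _] : exists k : 'I_(dimN M), E1 0 k != E2 0 k.
  by apply/existsP; apply: contra_neqT E12 => /existsPn E12; apply/rowP => k;
    apply/eqP; have := E12 k; rewrite negbK.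
have hplant := nash_has_plant (enum_val k) hK nash1.
have tot0 := nash_total_volume hK nash1.
have [optp1 optc1 _] := nash1.
have [optp2 optc2] := nash_exchange hK nash1 nash2.
have VE c : consumer_eqs c (V1 c) by have [[]] := optc1 c.
have segment t : 0 <= t <= 1 ->
    ~ SbarM M (t *: (E2 - E1) + E1) /\ Z (t *: (E2 - E1) + E1) = 0.
  move=> t01.
  have optp p := optimal_segment (@Psi_p_price_taking _ _ _ _ M p) t01
    (optp1 p) (optp2 p).
  have optc c := optimal_segment (@Psi_c_price_taking _ _ _ _ M c) t01
    (optc1 c) (optc2 c).
  have nS := balanced_notin_SbarM hA hplant optp VE tot0.
  split=> //; rewrite hZ addrC -[RHS]tot0; congr (_ + _); apply: eq_bigr => i _.
  - have [_ /(_ _ nS) optE] := hZc i.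
    have VZ : [set Zc i (t *: (E2 - E1) + E1)] (V1 i).
      by rewrite -optE; exact: optc.
    exact/esym.
  - have [_ /(_ _ nS) optE] := hZp i.
    have : [set dV v | v in @optimal_p _ _ _ _ M i (t *: (E2 - E1) + E1)]
      (dV (v1 i)) by exists (v1 i) => //; exact: optp.
    by rewrite optE => /esym.
have contZ z : ~ SbarM M z -> {for z, continuous Z}.
  move=> nSz.
  have -> : Z = fun E => \sum_p Zp p E + \sum_c Zc c E by apply/funext.
  have cont F : PCinfty (~` SbarM M) F -> {for z, continuous F}.
    by move=> [oS + _]; rewrite continuous_open_subspace// => /(_ z); apply;
      rewrite inE.
  have contp : {for z, continuous (fun E => \sum_p Zp p E)}.
    by apply: continuous_sum => p; apply: cont; have [] := hZp p.
  have contc : {for z, continuous (fun E => \sum_c Zc c E)}.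
    by apply: continuous_sum => c; apply: cont; have [] := hZc c.
  exact: cvgD contp contc.
have nS1 : ~ SbarM M E1.
  by have [] := segment 0; rewrite ?lexx ?ler01// scale0r add0r.
have := piecewise_isolates 0 contZ (hZi _ nS1) (hneg _ nS1) h0.
move=> [eps /= eps0 isolated].
have t0 : 0 < Num.min 1 (eps / 2) by rewrite lt_min ltr01 divr_gt0.
have tle : Num.min 1 (eps / 2) <= 1 by rewrite ge_min lexx.
have [_ Zt] := segment (Num.min 1 (eps / 2)) ltac:(by rewrite ltW).
have := isolated (Num.min 1 (eps / 2)); rewrite /= sub0r normrN gtr0_norm//.
rewrite gt_eqF// Zt eqxx => H.
suff /H : Num.min 1 (eps / 2) < eps by move/(_ isT).
by rewrite gt_min; apply/orP; right; lra.
Qed.
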